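(* Up to isomorphism, there are exactly ten graphs $G$ with $\operatorname{diam}(G)=2$ and exactly $11$ vertices such that $\gamma_g(G)=5$ (equivalently, such that $\gamma_g(G)=\left\lceil \frac{n(G)}{2}\right\rceil-\left\lfloor \frac{n(G)}{11}\right\rfloor$, where $n(G)=11$).
   Context: Graphs are finite, simple and undirected; $n(G)$ is the number of vertices. A vertex dominates itself and its neighbors. The domination game on a graph $G$ is played by Dominator and Staller, who alternately select vertices of $G$; each selected vertex must dominate at least one vertex not dominated by the previously selected vertices. The game ends when the selected vertices form a dominating set of $G$. Dominator aims to finish the game in as few moves as possible, Staller aims for the opposite. In the D-game Dominator makes the first move. The game domination number $\gamma_g(G)$ is the total number of vertices selected in the D-game when both players play optimally. *)

(* Defs.v *)
From mathcomp Require Import all_boot.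

Set Implicit Arguments.
Unset Strict Implicit.
Unset Printing Implicit Defensive.

Record sgraph := SGraph {
  vertex :> finType;
  adj : rel vertex;
  adj_sym : symmetric adj;
  adj_irr : irreflexive adj
}.

Definition isomorphic (G H : sgraph) : Prop :=
  exists2 f : G -> H, bijective f & forall x y, adj (f x) (f y) = adj x y.

Section Distance.
Variable G : sgraph.

Definition walk (k : nat) (u v : G) : bool :=
  [exists p : k.-tuple G, path (@adj G) u p && (last u p == v)].

(* Least length of a walk from u to v. A shortest walk has length < #|G|; when
   there is none the value is the junk #|G|, which diam never uses. *)
Definition dist (u v : G) : nat :=
  find (fun k => walk k u v) (iota 0 #|G|).

Definition connected : bool := [forall u : G, forall v : G, connect (@adj G) u v].

(* None stands for the infinite diameter of a disconnected graph. *)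
Definition diam : option nat :=
  if connected then Some (\max_(u : G) \max_(v : G) dist u v) else None.

Lemma distP (u v : G) : connect (@adj G) u v ->
  walk (dist u v) u v /\ forall k, walk k u v -> dist u v <= k.
Proof.
have cardG0 : 0 < #|G| by apply/card_gt0P; exists u.
move=> /connectP[p0 pth lst].
have [j jlt wj] : exists2 j, j < #|G| & walk j u v.
  case/shortenP: pth lst => p pth up _ lst.
  exists (size p).
    by rewrite -[_ < _]/(size (u :: p) <= _) -(card_uniqP up) max_card.
  by apply/existsP; exists (in_tuple p); rewrite /= pth -lst eqxx.
have hw : has (fun k => walk k u v) (iota 0 #|G|).
  by apply/hasP; exists j; rewrite // mem_iota.
have dlt : dist u v < #|G| by move: hw; rewrite has_find size_iota.
split; first by have := nth_find 0 hw; rewrite nth_iota.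
move=> k wk; rewrite leqNgt; apply/negP => kd.
by have := before_find 0 kd; rewrite nth_iota ?wk // (ltn_trans kd dlt).
Qed.

End Distance.

Lemma bigminn_le (I : finType) (P : pred I) (F : I -> nat) m i :
  P i -> \big[minn/m]_(j | P j) F j <= F i.
Proof.
move=> Pi; have := mem_index_enum i; elim: (index_enum I) => // j s IHs.
rewrite inE big_cons => /predU1P[<-|/IHs le_s]; first by rewrite Pi geq_minl.
by case: ifP => // _; apply: leq_trans (geq_minr _ _) le_s.
Qed.

Section DominationGame.
Variable G : sgraph.
Implicit Types (A : {set G}) (v w : G) (d : bool) (k : nat).

Definition closed_nbh v : {set G} := [set w | (w == v) || adj v w].

Definition dominated A : {set G} := \bigcup_(v in A) closed_nbh v.

Definition dominating A : bool := dominated A == [set: G].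

Definition legal A : {set G} := [set v | ~~ (closed_nbh v \subset dominated A)].

(* Number of moves still to be made under optimal play when the vertices of A
   have been selected and it is Dominator's (d = true) or Staller's (d = false)
   turn. The recursion is on a bound k on the number of remaining moves; the
   bound #|G| is enough (moves_leftE), and since all values are at most #|G|
   (moves_left_bound), so is #|G| as the default of the minimum. *)
Fixpoint moves_left_upto k d A : nat :=
  if k is k'.+1 then
    if dominating A then 0 else
      (if d then \big[minn/#|G|]_(v in legal A) moves_left_upto k' false (v |: A)
       else \max_(v in legal A) moves_left_upto k' true (v |: A)).+1
  else 0.

Definition moves_left d A : nat := moves_left_upto #|G| d A.

Definition game_domination_number : nat := moves_left true set0.

Lemma dominatedU1 v A : dominated (v |: A) = closed_nbh v :|: dominated A.
Proof. by rewrite /dominated bigcup_setU big_set1. Qed.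

Lemma legal_card v A : v \in legal A ->
  #|~: dominated (v |: A)| < #|~: dominated A|.
Proof.
rewrite inE => vl; apply: proper_card; rewrite dominatedU1 properE !setCS subsetUr /=.
by rewrite subUset (negPf vl).
Qed.

Lemma dominating_legal A : dominating A = (legal A == set0).
Proof.
apply/eqP/eqP => [domA | leg0].
  by apply/setP=> v; rewrite !inE domA subsetT.
apply/setP=> v; have := in_set0 v; rewrite -leg0 !inE => /negbFE/subsetP.
by apply; rewrite inE eqxx.
Qed.

Lemma moves_left_upto_fuel k k' d A :
  #|~: dominated A| <= k -> #|~: dominated A| <= k' ->
  moves_left_upto k d A = moves_left_upto k' d A.
Proof.
have dom0 B : #|~: dominated B| <= 0 -> dominating B.
  rewrite leqn0 cards_eq0 => /eqP domB; rewrite /dominating.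
  by rewrite -(setCK (dominated B)) domB setC0.
elim: k k' d A => [|k IH] [|k'] d A //= hk hk'.
- by rewrite (dom0 _ hk).
- by rewrite (dom0 _ hk').
case: ifP => // _; congr _.+1; case: d; apply: eq_bigr => v vl; apply: IH;
  by rewrite -ltnS (leq_trans (legal_card vl)).
Qed.

Lemma moves_leftE d A : moves_left d A =
  if dominating A then 0 else
    (if d then \big[minn/#|G|]_(v in legal A) moves_left false (v |: A)
     else \max_(v in legal A) moves_left true (v |: A)).+1.
Proof.
rewrite /moves_left (@moves_left_upto_fuel #|G| #|G|.+1) ?max_card //.
by rewrite ltnW // ltnS max_card.
Qed.

Lemma moves_left_bound d A : moves_left d A <= #|~: dominated A|.
Proof.
have [n] := ubnP #|~: dominated A|; elim: n d A => // n IH d A ltn.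
rewrite moves_leftE; case: ifPn => // ndom.
have step e v : v \in legal A -> moves_left e (v |: A) < #|~: dominated A|.
  move=> vl; have lt := legal_card vl; apply: leq_ltn_trans (lt).
  by apply: IH; apply: leq_trans lt _.
have [v vl] : exists v, v \in legal A.
  by apply/set0Pn; rewrite -dominating_legal.
case: d; last first.
  rewrite -(ltn_predK (step true v vl)) ltnS; apply/bigmax_leqP => w wl.
  by rewrite -ltnS (ltn_predK (step true v vl)); apply: step.
by apply: leq_ltn_trans (step false v vl); apply: (bigminn_le (P := [in legal A])).
Qed.

End DominationGame.

(* Main.v *)
Require Import Defs.
From mathcomp Require Import all_boot.

Set Implicit Arguments.
Unset Strict Implicit.
Unset Printing Implicit Defensive.

(** Let G have 11 vertices, diameter 2 and game domination number at least 5,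
    that is, suppose that Dominator cannot finish within four moves. In
    diameter 2, Dominator facing at most three undominated vertices finishes
    within two moves: some vertex dominates two of them, and a single
    undominated vertex is dominated by any legal move of Staller
    ([finish2_card]). Let Dominator open with a vertex v of maximum degree D,
    let s be a reply of Staller which keeps the game alive, C the set of
    vertices newly dominated by s, and T the set of those still undominated.
    Then T has at least four elements, and every vertex leaves at least two of
    them undominated. Since D is at least 4 by the Moore bound ([moore]), and
    D + #|C| + #|T| = 10, the pair (D, #|C|) is (5, 1), (4, 1) or (4, 2), while
    s is adjacent to v or not: six cases.

    Each case is settled by a backtracking search ([search]) over the graphs on
    0, ..., 10, in which v is 0, its neighbours are 1, ..., D, the set C comes
    next, T is last, and s is the first neighbour of v or the first element of
    C. A node of the search is a pair of matrices that bound the closed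
    adjacency matrix from below and from above. A branch is cut when a degree
    exceeds D, when two vertices are forced to be at distance greater than 2,
    when a vertex dominates all but at most one element of T, when the edges
    decided so far let Dominator finish within four moves ([bfinish]), or when
    exchanging two consecutive labels would give a lexicographically larger
    graph; the last cut is sound because one may start from a labelling that
    maximises the code of the graph ([run_search_sound]). All the graphs left
    embed into the ten graphs of [extremal] ([six_searches]). Conversely the
    same evaluation of the game is exact on a completely known graph
    ([bfinish_sound], [bfinish_complete]); it shows that the ten graphs have the stated
    invariants ([extremal_ok]), and an exhaustive search for isomorphisms that
    they are pairwise non-isomorphic ([extremal_distinct]). *)

(** * The domination game and graphs of diameter 2 *)

Section Game.
Variable G : sgraph.
Implicit Types (A R : {set G}) (u v w x : G).

(** With R the set of undominated vertices and Dominator (d = true) or Staller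
    (d = false) to move, Dominator can ensure that at most k more moves are
    made. Dominator is not bound to play legal moves here: by [finish_sub] this
    does not help. *)
Fixpoint finish k (d : bool) R : bool :=
  (R == set0) ||
  (if k is k'.+1 then
     if d then [exists v, finish k' false (R :\: closed_nbh v)]
     else [forall v, (closed_nbh v :&: R != set0) ==>
                     finish k' true (R :\: closed_nbh v)]
   else false).

Lemma finish_set0 k d : finish k d set0.
Proof. by case: k => [|k] /=; rewrite eqxx. Qed.

(** The continuation principle: fewer undominated vertices never hurt
    Dominator. *)
Lemma finish_sub k d R R' : R' \subset R -> finish k d R -> finish k d R'.
Proof.
elim: k d R R' => [|k IH] d R R' sR /=.
  by rewrite !orbF => /eqP R0; rewrite R0 subset0 in sR.
case/orP => [/eqP R0|H]; first by rewrite R0 subset0 in sR; rewrite sR.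
apply/orP; right; case: d H => [/existsP[v Hv]|/forallP H].
  by apply/existsP; exists v; apply: IH Hv; apply: setSD.
apply/forallP=> v; apply/implyP=> Nv.
apply: IH (implyP (H v) _); first exact: setSD.
by apply: contra_neq Nv => R0; apply/eqP; rewrite -subset0 -R0; apply: setIS.
Qed.

Lemma closed_nbhC u v : (u \in closed_nbh v) = (v \in closed_nbh u).
Proof. by rewrite !inE eq_sym adj_sym. Qed.

Lemma closed_nbh_refl v : v \in closed_nbh v.
Proof. by rewrite inE eqxx. Qed.

Lemma legalE A v :
  (v \in legal A) = (closed_nbh v :&: ~: dominated A != set0).
Proof. by rewrite inE -setDE setD_eq0. Qed.

Lemma undominatedU1 A v :
  ~: dominated (v |: A) = ~: dominated A :\: closed_nbh v.
Proof. by rewrite dominatedU1 setCU setDE setIC. Qed.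

Lemma bigminn_ge (I : finType) (P : pred I) (F : I -> nat) n m :
  n <= m -> (forall i, P i -> n <= F i) -> n <= \big[minn/m]_(i | P i) F i.
Proof.
by move=> nm nF; elim/big_ind: _ => // x y nx ny; rewrite leq_min nx.
Qed.

(** The value of the game in terms of [finish]. *)
Lemma moves_left_finish k d A :
  (moves_left d A <= k) = finish k d (~: dominated A).
Proof.
elim: k d A => [|k IH] d A; rewrite moves_leftE /=;
  have -> : dominating A = (~: dominated A == set0)
    by rewrite /dominating -(inj_eq (@setC_inj _)) setCT.
  by case: eqP.
case: eqP => [//|/eqP nA /=]; rewrite ltnS.
have [w wl] : exists w, w \in legal A.
  apply/set0Pn; rewrite -dominating_legal /dominating.
  by rewrite -(inj_eq (@setC_inj _)) setCT.
case: d; last first.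
  apply/bigmax_leqP/forallP => [H v|H v vl].
    by apply/implyP; rewrite -legalE -undominatedU1 -IH; apply: H.
  by rewrite IH undominatedU1; apply: (implyP (H v)); rewrite -legalE.
apply/idP/existsP => [Hmin|[v Hv]]; last first.
  suff [u ul Hu] : exists2 u, u \in legal A &
      finish k false (~: dominated A :\: closed_nbh u).
    rewrite -undominatedU1 -IH in Hu; apply: leq_trans Hu.
    exact: (bigminn_le (P := [in legal A])).
  (* An illegal v dominates nothing new, so any legal move does as well. *)
  have [vl|] := boolP (v \in legal A); first by exists v.
  rewrite legalE negbK setIC => /eqP vA; exists w => //.
  apply: finish_sub Hv.
  suff -> : ~: dominated A :\: closed_nbh v = ~: dominated A.
    exact: subsetDl.
  by apply/setDidPl; rewrite -setI_eq0 vA.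
have [[v /andP[vl Hv]]|none] :
  (exists v, (v \in legal A) && (moves_left false (v |: A) <= k)) \/
  (forall v, v \in legal A -> k < moves_left false (v |: A)).
- have [/existsP|/existsPn H] :=
    boolP [exists v, (v \in legal A) && (moves_left false (v |: A) <= k)].
    by left.
  by right=> v vl; have := H v; rewrite vl -ltnNge.
- by exists v; rewrite -undominatedU1 -IH.
have : k < \big[minn/#|G|]_(v in legal A) moves_left false (v |: A).
  apply: bigminn_ge => //; apply: leq_trans (none _ wl) _.
  by apply: leq_trans (moves_left_bound _ _) (max_card _).
by rewrite ltnNge Hmin.
Qed.

Lemma gamma_finish k :
  (game_domination_number G <= k) = finish k true [set: G].
Proof.
by rewrite /game_domination_number moves_left_finish /dominated big_set0 setC0.
Qed.

(** Any two vertices are at distance at most 2. *)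
Definition within2 : Prop :=
  forall u v, exists2 w, u \in closed_nbh w & v \in closed_nbh w.

Lemma finish1_card R : #|R| <= 1 -> finish 1 false R.
Proof.
move=> R1 /=; apply/orP; right; apply/forallP=> v; apply/implyP=> /set0Pn[x].
rewrite inE orbF => /andP[xv xR]; rewrite setD_eq0.
apply/subsetP=> y yR; suff -> : y = x by [].
by apply: (card_le1_eqP R1).
Qed.

Lemma finish2_card R : within2 -> #|R| <= 3 -> finish 2 true R.
Proof.
move=> cl R3; have [->|[x xR]] := set_0Vmem R; first exact: finish_set0.
suff [v Hv] : exists v, #|R :\: closed_nbh v| <= 1.
  by apply/orP; right; apply/existsP; exists v; apply: finish1_card.
have Rx : #|R :\ x| <= 2 by rewrite (cardsD1 x R) xR in R3.
have [R0|[y yR]] := set_0Vmem (R :\ x).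
  exists x; suff -> : R :\: closed_nbh x = set0 by rewrite cards0.
  apply/eqP; rewrite -subset0 -R0; apply: setDS.
  by rewrite sub1set closed_nbh_refl.
have [w xw yw] := cl x y; exists w.
have Rxy : #|R :\ x :\ y| <= 1 by rewrite (cardsD1 y (R :\ x)) yR in Rx.
apply: leq_trans Rxy; apply: subset_leq_card; apply/subsetP=> z.
rewrite !in_setD !in_set1 => /andP[zw ->]; rewrite andbT.
by apply/andP; split; apply: contraNneq zw => ->.
Qed.

(** The open neighbourhood. *)
Definition nbh v : {set G} := closed_nbh v :\ v.

Lemma card_closed_nbh v : #|closed_nbh v| = #|nbh v|.+1.
Proof. by rewrite (cardsD1 v) closed_nbh_refl. Qed.

(** The Moore bound for diameter 2. *)
Lemma moore v k : within2 -> (forall u, #|closed_nbh u| <= k.+1) ->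
  #|G| <= (k ^ 2).+1.
Proof.
move=> cl dk.
have cov : [set: G] \subset v |: \bigcup_(u in nbh v) (closed_nbh u :\ v).
  apply/subsetP=> x _; rewrite in_setU1; have [//|xv /=] := eqVneq x v.
  have [w xw vw] := cl x v; apply/bigcupP.
  have [wv|wv] := eqVneq w v.
    by exists x; rewrite !in_setD1 ?xv ?closed_nbh_refl //= -wv.
  by exists w; rewrite !in_setD1 ?xv ?wv //= closed_nbhC.
rewrite -cardsT; apply: leq_trans (subset_leq_card cov) _.
rewrite cardsU1 -add1n; apply: leq_add; first exact: leq_b1.
have bigcup_card (A : {set G}) (F : G -> {set G}) :
    #|\bigcup_(u in A) F u| <= \sum_(u in A) #|F u|.
  elim/big_ind2: _ => [|X m Y n Xm Yn|//]; first by rewrite cards0.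
  by rewrite cardsU (leq_trans (leq_subr _ _)) ?leq_add.
apply: leq_trans (bigcup_card _ _) _.
apply: (@leq_trans (\sum_(u in nbh v) k)).
  apply: leq_sum => u; rewrite in_setD1 => /andP[_ uv].
  by rewrite -ltnS (leq_trans _ (dk u)) // (cardsD1 v (closed_nbh u)) closed_nbhC uv.
by rewrite sum_nat_const leq_mul2r -ltnS -card_closed_nbh dk orbT.
Qed.

Lemma walkP k u v :
  reflect (exists p, [/\ size p = k, path (@adj G) u p & last u p = v])
          (walk k u v).
Proof.
apply: (iffP existsP) => [[p /andP[pth /eqP lst]]|[p [<- pth lst]]].
  by exists p; rewrite size_tuple.
by exists (in_tuple p); rewrite /= pth lst eqxx.
Qed.

Lemma walk_le2 u v k : k <= 2 -> walk k u v ->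
  exists2 w, u \in closed_nbh w & v \in closed_nbh w.
Proof.
move=> k2 /walkP[p [sp pth lst]]; rewrite -{}sp in k2.
case: p k2 pth lst => [_ _ <-|x [_ /= /andP[ux _] <-|y [_|//]]] /=.
- by exists u; rewrite closed_nbh_refl.
- by exists u; rewrite ?closed_nbh_refl // inE ux orbT.
- move=> /and3P[ux xy _] <-; exists x; rewrite inE ?xy ?orbT //.
  by rewrite adj_sym ux orbT.
Qed.

Lemma walk_le1 u v k : k <= 1 -> walk k u v -> v \in closed_nbh u.
Proof.
move=> k1 /walkP[p [sp pth lst]]; rewrite -{}sp in k1.
case: p k1 pth lst => [_ _ <-|x [_ /= /andP[ux _] <-|//]] /=.
  exact: closed_nbh_refl.
by rewrite inE ux orbT.
Qed.

Lemma closed_nbh_connect u v : v \in closed_nbh u -> connect (@adj G) u v.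
Proof.
by rewrite inE => /predU1P[->|/connect1//]; apply: connect0.
Qed.

Lemma nbh_walk u v : v \in closed_nbh u -> exists2 k, k <= 1 & walk k u v.
Proof.
rewrite inE => /predU1P[->|uv].
  by exists 0 => //; apply/walkP; exists [::].
by exists 1 => //; apply/walkP; exists [:: v]; rewrite /= uv.
Qed.

Lemma within2_walk u v : within2 -> exists2 k, k <= 2 & walk k u v.
Proof.
move=> cl; have [w uw vw] := cl u v.
rewrite closed_nbhC in uw; have [i i1 /walkP[p [sp pp lp]]] := nbh_walk uw.
have [j j1 /walkP[q [sq pq lq]]] := nbh_walk vw.
exists (i + j); first by rewrite (leq_add i1 j1).
apply/walkP; exists (p ++ q).
by rewrite size_cat cat_path last_cat lp sp sq pp pq lq.
Qed.

Lemma diam2P :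
  diam G = Some 2 <-> within2 /\ exists u v, v \notin closed_nbh u.
Proof.
rewrite /diam; split.
  case: ifP => // /forallP con [diam2].
  have conn u v : connect (@adj G) u v by apply: (forallP (con u)).
  split.
    move=> u v; have [wuv _] := distP (conn u v).
    apply: walk_le2 wuv; rewrite -diam2.
    by apply: (bigmax_sup u) => //; apply: (bigmax_sup v).
  case: (pickP (fun p : G * G => p.2 \notin closed_nbh p.1)) => [[u v]|none].
    by exists u, v.
  suff : 2 <= 1 by [].
  rewrite -{1}diam2; apply/bigmax_leqP=> u _; apply/bigmax_leqP=> v _.
  have /negPn uv := negbT (none (u, v)).
  have [k k1 wk] := nbh_walk uv.
  by apply: leq_trans k1; apply: (distP (conn u v)).2.
move=> [cl [u [v uv]]].
have conn x y : connect (@adj G) x y.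
  have [w xw yw] := cl x y; apply: (@connect_trans _ _ w).
    by apply: closed_nbh_connect; rewrite closed_nbhC.
  exact: closed_nbh_connect.
have -> : connected G by apply/forallP=> x; apply/forallP=> y; apply: conn.
congr Some; apply/eqP; rewrite eqn_leq; apply/andP; split.
  apply/bigmax_leqP=> x _; apply/bigmax_leqP=> y _.
  have [k k2 wk] := within2_walk x y cl.
  by apply: leq_trans k2; apply: (distP (conn x y)).2.
apply: (bigmax_sup u) => //; apply: (bigmax_sup v) => //.
rewrite ltnNge; apply: contra uv => d1.
by apply: walk_le1 d1 (distP (conn u v)).1.
Qed.
End Game.

(** * Bit vectors and bit matrices *)

(** Versions of [has], [all] and [all2] that stop early also when evaluated by
    value. *)
Fixpoint lazy_has T (f : T -> bool) s :=
  if s is x :: s' then if f x then true else lazy_has f s' else false.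

Fixpoint lazy_all T (f : T -> bool) s :=
  if s is x :: s' then if f x then lazy_all f s' else false else true.

Fixpoint lazy_all2 S T (f : S -> T -> bool) s t :=
  match s, t with
  | x :: s', y :: t' => if f x y then lazy_all2 f s' t' else false
  | _, _ => true
  end.

Lemma lazy_hasE T (f : T -> bool) s : lazy_has f s = has f s.
Proof. by elim: s => //= x s ->; case: (f x). Qed.

Lemma lazy_allE T (f : T -> bool) s : lazy_all f s = all f s.
Proof. by elim: s => //= x s ->; case: (f x). Qed.

Lemma lazy_all2P S T x0 y0 (f : S -> T -> bool) s t :
  reflect (forall i, i < size s -> i < size t -> f (nth x0 s i) (nth y0 t i))
          (lazy_all2 f s t).
Proof.
elim: s t => [|x s IH] [|y t] /=; try by constructor.
case fxy: (f x y); last by constructor=> H; move: (H 0 isT isT); rewrite /= fxy.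
by apply: (iffP (IH t)) => H => [[|i]|i]; [|apply: H|apply: (H i.+1)].
Qed.

(** Bit vectors stand for sets of indices; positions beyond the end count as
    false. *)
Fixpoint meets (r s : bitseq) : bool :=
  match r, s with
  | a :: r', b :: s' =>
      if a then if b then true else meets r' s' else meets r' s'
  | _, _ => false
  end.

Fixpoint minus (r s : bitseq) : bitseq :=
  match r, s with
  | a :: r', b :: s' => (if b then false else a) :: minus r' s'
  | _, _ => r
  end.

Fixpoint atmost k (r : bitseq) : bool :=
  match r with
  | [::] => true
  | b :: r' =>
      if b then if k is k'.+1 then atmost k' r' else false else atmost k r'
  end.

Lemma meetsP r s :
  reflect (exists i, nth false r i && nth false s i) (meets r s).
Proof.
have -> : meets r s = has id [seq p.1 && p.2 | p <- zip r s].
  by elim: r s => [|a r IH] [|b s] //=; rewrite IH; case: a b => [] [].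
apply: (iffP (has_nthP false)) => [[i ilt]|[i]].
  rewrite size_map in ilt; rewrite (nth_map (false, false)) //.
  rewrite nth_zip_cond ilt /= => H; exists i; exact: H.
move=> /andP[ri si]; have ir : i < size r.
  by case: ltnP ri => // ?; rewrite nth_default.
have iss : i < size s by case: ltnP si => // ?; rewrite nth_default.
exists i; first by rewrite size_map size_zip leq_min ir iss.
rewrite (nth_map (false, false)) ?size_zip ?leq_min ?ir ?iss //.
by rewrite nth_zip_cond size_zip leq_min ir iss /= ri si.
Qed.

Lemma nth_minus r s i :
  nth false (minus r s) i = nth false r i && ~~ nth false s i.
Proof.
elim: r s i => [|a r IH] [|b s] [|i] //=; rewrite ?nth_nil ?andbT //.
by case: b; rewrite ?andbF ?andbT.
Qed.

Lemma atmostE k r : atmost k r = (count id r <= k).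
Proof. by elim: r k => [|[] r IH] [|k] //=; rewrite ?IH. Qed.

(** Matrices of booleans, given by their rows. *)
Definition mat := seq bitseq.

Definition bit (M : mat) i j := nth false (nth [::] M i) j.

Definition set_bit i j b (M : mat) : mat :=
  set_nth [::] M i (set_nth false (nth [::] M i) j b).

(** Both entries of an edge are set. *)
Definition set_edge i j b M := set_bit i j b (set_bit j i b M).

Lemma bit_set_bit i j b M x y :
  bit (set_bit i j b M) x y = if (x == i) && (y == j) then b else bit M x y.
Proof.
rewrite /bit /set_bit nth_set_nth /=; case: eqP => //= ->.
by rewrite nth_set_nth /=.
Qed.

Lemma bit_set_edge i j b M x y :
  bit (set_edge i j b M) x y =
  if (x == i) && (y == j) || (x == j) && (y == i) then b else bit M x y.
Proof. by rewrite !bit_set_bit; case: ifP => //; case: ifP. Qed.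

Lemma size_set_edge n i j b M :
  i < n -> j < n -> size M = n -> size (set_edge i j b M) = n.
Proof.
move=> ilt jlt sM; rewrite /set_edge /set_bit !size_set_nth sM.
by rewrite (maxn_idPr jlt) (maxn_idPr ilt).
Qed.

(** * The game on a partially known graph *)

(** When at most this number of vertices is undominated, Dominator finishes
    within k moves in any graph of diameter 2. *)
Definition surely k (d : bool) :=
  match k, d with 1, false => 1 | 2, true => 3 | _, _ => 0 end.

(** The counterpart of [finish] for a graph whose closed adjacency matrix lies
    between Y and P, entrywise. Dominations are counted only if certain (Y),
    while every possibly legal move (P) of Staller is considered; r contains
    the undominated vertices. *)
Fixpoint bfinish (Y P : mat) k (d : bool) r :=
  if atmost (surely k d) r then true else
  if k is k'.+1 then
    if d then lazy_has (fun y => bfinish Y P k' false (minus r y)) Y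
    else lazy_all2
      (fun y p => if meets p r then bfinish Y P k' true (minus r y) else true) Y P
  else false.

(** * Search for isomorphisms *)

(** The row ra of a new vertex agrees with the row rb of its image on the
    previous vertices, whose images are listed in m. *)
Fixpoint agree (ra : bitseq) (m : seq nat) (rb : bitseq) :=
  match m, ra with
  | y :: m', a :: ra' =>
      if nth false rb y then if a then agree ra' m' rb else false
      else if a then false else agree ra' m' rb
  | [::], _ => true
  | _, [::] => false
  end.

(** Backtracking search for an isomorphism onto the graph of b: m lists the
    images of the first vertices, and a the rows of those still to be mapped.
    Vertices of different degrees are not matched. *)
Fixpoint embeds (a b : mat) (m : seq nat) : bool :=
  if a is ra :: a' then
    lazy_has (fun x =>
      let rb := nth [::] b x in
      if x \in m then false else
      if agree ra m rb then
        if count id ra == count id rb then embeds a' b (rcons m x) else false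
      else false) (iota 0 (size b))
  else true.

(** * The backtracking search *)

(** The status of a pair of vertices: edge, non-edge or undecided. *)
Definition entry (Y P : mat) (v : nat * nat) : option bool :=
  if bit Y v.1 v.2 then Some true
  else if bit P v.1 v.2 then None else Some false.

(** A list of pairs of edges (e, e') encodes the constraint that the sequence of
    the e is lexicographically at least that of the e'. A step drops the
    decided part of the constraint; the result is [None] if it is violated, and
    empty if it is satisfied. *)
Fixpoint lex_step Y P (l : seq ((nat * nat) * (nat * nat))) :=
  if l is uv :: l' then
    match entry Y P uv.1, entry Y P uv.2 with
    | Some a, Some b =>
        if a then if b then lex_step Y P l' else Some [::]
        else if b then None else lex_step Y P l'
    | _, _ => Some l
    end
  else Some [::].

Fixpoint lex_steps Y P (ls : seq (seq ((nat * nat) * (nat * nat)))) :=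
  if ls is l :: ls' then
    match lex_step Y P l with
    | None => None
    | Some [::] => lex_steps Y P ls'
    | Some l1 =>
        if lex_steps Y P ls' is Some ls1 then Some (l1 :: ls1) else None
    end
  else Some [::].

Section Search.
Variables (n D : nat) (U : bitseq) (targets : seq mat).

(** Tests after adding the edge ij: the degrees of i and j are at most D, neither
    of them dominates all but one element of U, and Dominator cannot be seen to
    finish within four moves. The last test is the costly one; it is left out
    for edges that meet U, which only affects the size of the search. *)
Definition edge_ok i j Y P : bool :=
  let ri := nth [::] Y i in let rj := nth [::] Y j in
  if ~~ atmost D.+1 ri then false else if ~~ atmost D.+1 rj then false else
  if atmost 1 (minus U ri) then false else
  if atmost 1 (minus U rj) then false else
  if nth false U i then true else if nth false U j then true else
  ~~ bfinish Y P 4 true (nseq n true).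

(** Test after excluding the edge ij: distances from i and from j can still be
    at most 2. *)
Definition nonedge_ok i j P : bool :=
  if lazy_all (meets (nth [::] P i)) P then lazy_all (meets (nth [::] P j)) P
  else false.

(** True if every completion of (Y, P) on the edges vs is excluded by one of the
    tests, violates one of the constraints ls, or embeds into one of the
    targets. *)
Fixpoint search (vs : seq (nat * nat)) ls Y P : bool :=
  if vs is (i, j) :: vs' then
    if entry Y P (i, j) is Some _ then search vs' ls Y P else
    let Y' := set_edge i j true Y in
    let P' := set_edge i j false P in
    if (if edge_ok i j Y' P then
          if lex_steps Y' P ls is Some ls' then search vs' ls' Y' P else true
        else true)
    then if nonedge_ok i j P' then
           if lex_steps Y P' ls is Some ls' then search vs' ls' Y P' else true
         else true
    else false
  else
    if bfinish Y P 4 true (nseq n true) then true else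
    if Y == P then lazy_has (fun b => embeds Y b [::]) targets else false.

End Search.

(** * Soundness with respect to a labelled graph *)

Section Labelled.
Variables (G : sgraph) (n : nat) (lab : nat -> G).
Hypothesis lab_inj : {in gtn n &, injective lab}.
Hypothesis lab_surj : forall x, exists2 i, i < n & lab i = x.
Implicit Types (R : {set G}) (r : bitseq) (Y P : mat).

(** The closed adjacency matrix of G, in the labelling. *)
Definition cadj i j := [&& i < n, j < n & lab j \in closed_nbh (lab i)].

Lemma cadjC i j : cadj i j = cadj j i.
Proof. by rewrite /cadj closed_nbhC; case: (i < n); case: (j < n). Qed.

(** The closed adjacency matrix lies between Y and P. *)
Definition fits Y P := [/\ size Y = n, size P = n,
  forall i j, bit Y i j -> cadj i j & forall i j, cadj i j -> bit P i j].

(** The bit vector r contains, or is contained in, the set of labels of R. *)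
Definition covers R r := forall i, i < n -> lab i \in R -> nth false r i.
Definition within R r := forall i, nth false r i -> i < n /\ lab i \in R.

Lemma countE r : count id r = size [seq i <- iota 0 (size r) | nth false r i].
Proof. by rewrite size_filter -{1}(mkseq_nth false r) count_map. Qed.

Lemma covers_card R r : covers R r -> #|R| <= count id r.
Proof.
move=> out; rewrite cardE countE -(size_map lab).
apply: uniq_leq_size; first exact: enum_uniq.
move=> x; rewrite mem_enum => xR; have [i ilt ix] := lab_surj x.
apply/mapP; exists i => //; have ri : nth false r i by apply: out; rewrite ?ix.
rewrite mem_filter ri mem_iota /=.
by case: ltnP ri => // ?; rewrite nth_default.
Qed.

Lemma within_card R r : within R r -> count id r <= #|R|.
Proof.
move=> inn; rewrite cardE countE -(size_map lab).
apply: uniq_leq_size.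
  rewrite map_inj_in_uniq ?filter_uniq ?iota_uniq // => i j.
  rewrite !mem_filter => /andP[/inn[ilt _] _] /andP[/inn[jlt _] _].
  exact: lab_inj.
move=> x /mapP[i]; rewrite mem_filter => /andP[/inn[_ iR] _] ->.
by rewrite mem_enum.
Qed.

Lemma covers_minus Y P R r i : fits Y P -> covers R r ->
  covers (R :\: closed_nbh (lab i)) (minus r (nth [::] Y i)).
Proof.
case=> _ _ YM _ out j jlt; rewrite inE => /andP[nij jR].
rewrite nth_minus out //=; apply: contra nij => Yij.
by have /and3P[] := YM _ _ Yij.
Qed.

Lemma finish_surely k d R : within2 G -> #|R| <= surely k d -> finish k d R.
Proof.
move=> cl; have triv : #|R| <= 0 -> finish k d R.
  by rewrite leqn0 cards_eq0 => /eqP ->; apply: finish_set0.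
case: k d triv => [|[|[|k]]] [] //= triv; first exact: finish1_card.
exact: finish2_card.
Qed.

(** Evaluation on partial information never flatters Dominator. *)
Lemma bfinish_sound Y P k d R r : within2 G -> fits Y P -> covers R r ->
  bfinish Y P k d r -> finish k d R.
Proof.
move=> cl fit; have [sY sP YM MP] := fit.
have short k' d' R' r' : covers R' r' -> atmost (surely k' d') r' ->
    finish k' d' R'.
  move=> out; rewrite atmostE => le; apply: finish_surely => //.
  exact: leq_trans (covers_card out) le.
elim: k d R r => [|k IH] d R r out.
  by rewrite [bfinish _ _ _ _ _]/=; case: ifP => // /(short 0 d _ _ out).
rewrite [bfinish _ _ _ _ _]/=; case: ifP => [/(short k.+1 d _ _ out)//|_ /=].
case: d => H; apply/orP; right.
  move: H; rewrite lazy_hasE => /(has_nthP [::])[i _ /IH H].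
  by apply/existsP; exists (lab i); apply: H; apply: covers_minus fit out.
move/lazy_all2P: H => H; apply/forallP=> x; apply/implyP=> /set0Pn[y].
have [i ilt <-] := lab_surj x; have [j jlt <-] := lab_surj y.
rewrite inE => /andP[ij jR].
have := H [::] [::] i; rewrite sY sP ilt => /(_ isT isT).
have -> : meets (nth [::] P i) r.
  by apply/meetsP; exists j; rewrite out // andbT; apply: MP; rewrite /cadj ilt jlt.
by apply: IH; apply: covers_minus fit out.
Qed.

Lemma within_minus Y R r i : i < n -> (forall i j, cadj i j -> bit Y i j) ->
  within R r -> within (R :\: closed_nbh (lab i)) (minus r (nth [::] Y i)).
Proof.
move=> ilt MY inn j; rewrite nth_minus => /andP[/inn[jlt jR] nij]; split=> //.
rewrite inE jR andbT; apply: contra nij => ij.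
by apply: MY; rewrite /cadj ilt jlt.
Qed.

(** On a completely known graph, the evaluation misses no win of Dominator. *)
Lemma bfinish_complete Y k d R r : fits Y Y -> within R r ->
  finish k d R -> bfinish Y Y k d r.
Proof.
case=> sY _ YM MY.
have short k' d' r' : atmost (surely k' d') r' -> bfinish Y Y k' d' r'.
  by case: k' => [|k'] H; rewrite [bfinish _ _ _ _ _]/= H.
have fin0 k' d' R' r' : within R' r' -> R' = set0 -> bfinish Y Y k' d' r'.
  move=> inn R0; apply: short; rewrite atmostE.
  by rewrite (leq_trans (within_card inn)) // R0 cards0.
elim: k d R r => [|k IH] d R r inn.
  by rewrite /= orbF => /eqP/(fin0 0 d _ _ inn).
case/orP => [/eqP/(fin0 k.+1 d _ _ inn)//|H].
rewrite [bfinish _ _ _ _ _]/=; case: ifP => // _; case: d H.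
  case/existsP=> x; have [i ilt <-] := lab_surj x => H.
  rewrite lazy_hasE; apply/(has_nthP [::]); exists i; first by rewrite sY.
  by apply: IH H; apply: within_minus.
move=> /forallP H; apply/(@lazy_all2P _ _ [::] [::]) => i; rewrite sY => ilt _.
case: ifP => // /meetsP[j /andP[ij rj]]; have [jlt jR] := inn _ rj.
apply: IH (implyP (H (lab i)) _); first exact: within_minus.
apply/set0Pn; exists (lab j); rewrite inE jR andbT.
by have /and3P[] := YM _ _ ij.
Qed.

Lemma covers_full : covers setT (nseq n true).
Proof. by move=> i ilt _; rewrite nth_nseq ilt. Qed.

Lemma within_full : within setT (nseq n true).
Proof. by move=> i; rewrite nth_nseq; case: ltnP. Qed.

Lemma entryP Y P v b :
  fits Y P -> entry Y P v = Some b -> cadj v.1 v.2 = b.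
Proof.
case=> _ _ YM MP; rewrite /entry.
case: ifP => [/YM -> [] //|_]; case: ifP => // nP [<-].
by apply: contraFF nP; apply: MP.
Qed.

(** The constraint encoded by a list of pairs of edges. *)
Fixpoint lex_ge (l : seq ((nat * nat) * (nat * nat))) : bool :=
  if l is uv :: l' then
    if cadj uv.1.1 uv.1.2 == cadj uv.2.1 uv.2.2 then lex_ge l'
    else cadj uv.1.1 uv.1.2
  else true.

Lemma lex_stepP Y P l : fits Y P -> lex_ge l ->
  exists2 l', lex_step Y P l = Some l' & lex_ge l'.
Proof.
move=> fit; elim: l => [|[u v] l IH] /=; first by exists [::].
case eu: (entry Y P u) => [a|]; last by exists ((u, v) :: l).
case ev: (entry Y P v) => [b|]; last by exists ((u, v) :: l).
rewrite (entryP fit eu) (entryP fit ev); case: a b {eu ev} => [] [] //=.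
by exists [::].
Qed.

Lemma lex_stepsP Y P ls : fits Y P -> all lex_ge ls ->
  exists2 ls', lex_steps Y P ls = Some ls' & all lex_ge ls'.
Proof.
move=> fit; elim: ls => [|l ls IH] /=; first by exists [::].
case/andP=> /(lex_stepP fit)[l' -> l'P] /IH[ls' -> ls'P].
by case: l' l'P => [|p l'] l'P;
  [exists ls' | exists ((p :: l') :: ls')]; rewrite //= ls'P andbT.
Qed.

Lemma fits_edge Y P i j : fits Y P -> cadj i j -> fits (set_edge i j true Y) P.
Proof.
case=> sY sP YM MP ij; have /and3P[ilt jlt _] := ij.
split=> // [|x y]; first exact: size_set_edge.
rewrite bit_set_edge; case: ifP => [|_ /YM//].
by case/orP => /andP[/eqP-> /eqP->] _ //; rewrite cadjC.
Qed.

Lemma fits_nonedge Y P i j : fits Y P -> i < n -> j < n -> ~~ cadj i j ->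
  fits Y (set_edge i j false P).
Proof.
case=> sY sP YM MP ilt jlt ij.
split=> // [|x y xy]; first exact: size_set_edge.
rewrite bit_set_edge; case: ifP => [|_]; last exact: MP.
case/orP => /andP[/eqP ex /eqP ey]; move: xy; rewrite ex ey; last rewrite cadjC.
  by rewrite (negPf ij).
by rewrite (negPf ij).
Qed.

Section SearchSound.
Variables (D : nat) (T : {set G}) (U : bitseq) (targets : seq mat).
Hypothesis cl : within2 G.
Hypothesis deg : forall x : G, #|closed_nbh x| <= D.+1.
Hypothesis TU : covers T U.
Hypothesis cap : forall x : G, 1 < #|T :\: closed_nbh x|.
Hypothesis nofin : ~~ finish 4 true [set: G].

Lemma bfinish4F Y P : fits Y P -> bfinish Y P 4 true (nseq n true) = false.
Proof. by move=> fit; apply: contraNF nofin; apply: bfinish_sound fit covers_full. Qed.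

Lemma edge_okP Y P i j : fits Y P -> i < n -> j < n -> edge_ok n D U i j Y P.
Proof.
move=> fit; have [sY sP YM MP] := fit.
have deg_ok k : atmost D.+1 (nth [::] Y k).
  rewrite atmostE; apply: leq_trans (deg (lab k)); apply: within_card => m.
  by move=> /YM/and3P[].
have cap_ok k : k < n -> atmost 1 (minus U (nth [::] Y k)) = false.
  move=> klt; rewrite atmostE leqNgt; apply/negbF; apply: leq_trans (cap (lab k)) _.
  by apply: covers_card; apply: covers_minus fit TU.
move=> ilt jlt; rewrite /edge_ok (bfinish4F fit) !deg_ok !cap_ok //=.
by case: ifP => // _; case: ifP.
Qed.

Lemma nonedge_okP Y P i j : fits Y P -> i < n -> j < n -> nonedge_ok i j P.
Proof.
move=> [sY sP YM MP].
have ok k : k < n -> lazy_all (meets (nth [::] P k)) P.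
  move=> klt; rewrite lazy_allE; apply/(all_nthP [::]) => m; rewrite sP => mlt.
  have [w kw mw] := cl (lab k) (lab m); have [x xlt xw] := lab_surj w.
  apply/meetsP; exists x; rewrite -xw in kw mw.
  by apply/andP; split; apply: MP; rewrite /cadj ?klt ?mlt xlt closed_nbhC.
by move=> ilt jlt; rewrite /nonedge_ok !ok.
Qed.

Lemma search_sound vs ls Y P :
  all (fun v => (v.1 < n) && (v.2 < n)) vs -> all lex_ge ls -> fits Y P ->
  search n D U targets vs ls Y P ->
  exists Z, [/\ size Z = n, bit Z =2 cadj & has (fun b => embeds Z b [::]) targets].
Proof.
elim: vs ls Y P => [|[i j] vs IH] ls Y P.
  move=> _ _ fit; rewrite [search _ _ _ _ _ _ _ _]/search bfinish4F //.
  case: eqP => // YP.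
  rewrite lazy_hasE => H; exists Y; case: fit; rewrite -YP => sY _ YM MP.
  by split=> // x y; apply/idP/idP; [apply: YM | apply: MP].
rewrite /= => /andP[/andP[ilt jlt] vlt] lsP fit.
case: (entry _ _ _) => [_|]; first exact: IH fit.
have [ij|ij] := boolP (cadj i j).
  have fit' := fits_edge fit ij.
  have [ls' -> ls'P] := lex_stepsP fit' lsP.
  rewrite edge_okP //; case: ifP => // H _; exact: IH fit' H.
have fit' := fits_nonedge fit ilt jlt ij.
have [ls' -> ls'P] := lex_stepsP fit' lsP.
rewrite (nonedge_okP fit') //; case: ifP => // _; exact: IH fit'.
Qed.
End SearchSound.

End Labelled.

(** * Correctness of the search for isomorphisms *)

Lemma agreeP ra m rb :
  reflect (size m <= size ra /\
           forall i, i < size m -> nth false ra i = nth false rb (nth 0 m i))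
          (agree ra m rb).
Proof.
elim: m ra => [|y m IH] [|a ra] /=; try by constructor; split.
  by constructor; case.
have -> : (if nth false rb y then if a then agree ra m rb else false
           else if a then false else agree ra m rb) =
          (a == nth false rb y) && agree ra m rb by case: a (nth _ _ _) => [] [].
apply: (iffP andP) => [[/eqP ay /IH[sm H]]|[sm H]].
  by split=> // [[|i]] //=; apply: H.
by split; [apply/eqP/(H 0) | apply/IH; split=> // i; apply: (H i.+1)].
Qed.

Lemma embeds_sound a b m :
  uniq m -> all (gtn (size b)) m -> embeds a b m ->
  exists m', [/\ size m' = size a, uniq (m ++ m'), all (gtn (size b)) (m ++ m') &
    forall k i, k < size a -> i < size m + k ->
      bit a k i = bit b (nth 0 (m ++ m') (size m + k)) (nth 0 (m ++ m') i)].
Proof.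
elim: a m => [|ra a IH] m um lm /=; first by exists [::]; rewrite cats0.
rewrite lazy_hasE => /hasP[x]; rewrite mem_iota /= add0n => xb.
case: ifP => // xm; case: agreeP => // -[_ ag]; case: ifP => // _ /IH [||m'].
- by rewrite rcons_uniq xm.
- by rewrite all_rcons lm andbT.
case=> sm' um' lm' H; exists (x :: m').
rewrite -cat_rcons; split=> //=; first by rewrite sm'.
move=> [|k] i klt; rewrite ?addn0 => ilt.
  rewrite /bit /= ag // !nth_cat !size_rcons !nth_rcons ltnn eqxx ltnS leqnn.
  by rewrite ltnS (ltnW ilt) ilt.
by have := H k i klt; rewrite size_rcons addSnnS; apply.
Qed.

Lemma embeds_complete n a b (f : nat -> nat) :
  size a = n -> size b = n -> (forall i, i < n -> f i < n) ->
  {in gtn n &, injective f} ->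
  (forall i, i < n -> size (nth [::] a i) = n) ->
  (forall i, i < n -> count id (nth [::] a i) = count id (nth [::] b (f i))) ->
  (forall i j, i < n -> j < n -> bit a i j = bit b (f i) (f j)) ->
  embeds a b [::].
Proof.
move=> sa sb fn finj srow cnt fbit.
suff H d k : k + d = n -> embeds (drop k a) b [seq f i | i <- iota 0 k].
  by have := H n 0 (add0n n); rewrite drop0.
elim: d k => [|d IH] k kd.
  by rewrite drop_oversize // sa -kd addn0.
have klt : k < n by rewrite -kd addnS ltnS leq_addr.
rewrite (drop_nth [::]) ?sa //= lazy_hasE; apply/hasP; exists (f k).
  by rewrite mem_iota sb fn.
have -> : (f k \in [seq f i | i <- iota 0 k]) = false.
  apply/mapP => -[i]; rewrite mem_iota /= add0n => ik fki.
  have ei : k = i by apply: finj => //; apply: ltn_trans klt.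
  by rewrite ei ltnn in ik.
case: agreeP => [_|[]]; last first.
  rewrite size_map size_iota srow // ltnW //; split=> // i ik.
  rewrite (nth_map 0) ?size_iota // nth_iota // add0n.
  by apply: fbit => //; apply: ltn_trans klt.
rewrite cnt // eqxx.
have := IH k.+1; rewrite addSnnS => /(_ kd).
by rewrite -addn1 iotaD map_cat /= cats1 addn1.
Qed.

Section LabelledPair.
Variables (G H : sgraph) (n : nat) (labG : nat -> G) (labH : nat -> H).
Hypothesis labG_inj : {in gtn n &, injective labG}.
Hypothesis labG_surj : forall x, exists2 i, i < n & labG i = x.
Hypothesis labH_inj : {in gtn n &, injective labH}.
Hypothesis labH_surj : forall x, exists2 i, i < n & labH i = x.

Lemma adjE (K : sgraph) (x y : K) : adj x y = (y != x) && (y \in closed_nbh x).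
Proof.
by rewrite inE; have [->|_] := eqVneq y x; rewrite ?adj_irr.
Qed.

Lemma labelled_card (K : sgraph) (lab : nat -> K) :
  {in gtn n &, injective lab} -> (forall x, exists2 i, i < n & lab i = x) ->
  #|K| = n.
Proof.
move=> li ls; apply/eqP; rewrite eqn_leq -cardsT.
have := covers_card ls (@covers_full _ n lab).
have := within_card li (@within_full _ n lab).
by rewrite count_nseq mul1n => -> ->.
Qed.

Variables (a b : mat).
Hypotheses (sa : size a = n) (sb : size b = n).
Hypothesis aE : bit a =2 cadj n labG.
Hypothesis bE : bit b =2 cadj n labH.

(* The label of x in G. *)
Let idx x := index x [seq labG i | i <- iota 0 n].

Lemma idxP x : idx x < n /\ labG (idx x) = x.
Proof.
have xl : x \in [seq labG i | i <- iota 0 n].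
  by have [i ilt <-] := labG_surj x; rewrite map_f // mem_iota.
have ilt : idx x < n.
  by rewrite /idx -[X in _ < X](size_iota 0) -(size_map labG) index_mem.
split=> //; rewrite -[RHS](nth_index x xl) (nth_map 0) ?size_iota //.
by rewrite nth_iota.
Qed.

Lemma isomorphic_embeds : embeds a b [::] -> isomorphic G H.
Proof.
move/embeds_sound => [] // m [/= sm um lm bitm].
rewrite sa in sm bitm; rewrite sb in lm.
have mlt i : i < n -> nth 0 m i < n by move=> ilt; apply: (all_nthP 0 lm); rewrite sm.
pose f x := labH (nth 0 m (idx x)).
have finj : injective f.
  move=> x y /labH_inj; rewrite !inE !mlt ?(idxP _).1 // => /(_ isT isT) /eqP.
  rewrite nth_uniq ?sm ?(idxP _).1 // => /eqP exy.
  by rewrite -(idxP x).2 exy (idxP y).2.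
exists f.
  apply: inj_card_bij => //.
  by rewrite (labelled_card labG_inj labG_surj) (labelled_card labH_inj labH_surj).
suff nbhE x y : idx x <= idx y ->
    (f y \in closed_nbh (f x)) = (y \in closed_nbh x).
  move=> x y; rewrite !adjE (inj_eq finj); congr (_ && _).
  have [/nbhE //|/ltnW/nbhE] := leqP (idx x) (idx y).
  by rewrite closed_nbhC => ->; rewrite closed_nbhC.
rewrite leq_eqVlt => /predU1P[exy|lt].
  have -> : x = y by rewrite -(idxP x).2 exy (idxP y).2.
  by rewrite !closed_nbh_refl.
have [xlt ex] := idxP x; have [ylt ey] := idxP y.
have := bitm _ _ ylt lt; rewrite aE bE /cadj xlt ylt ex ey !mlt //=.
by rewrite closed_nbhC (closed_nbhC (labH _)) => ->.
Qed.

Lemma embeds_isomorphic :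
  (forall i, i < n -> size (nth [::] a i) = n) ->
  isomorphic G H -> embeds a b [::].
Proof.
move=> srow [f fbij fadj]; have finj := bij_inj fbij.
have fN x y : (f y \in closed_nbh (f x)) = (y \in closed_nbh x).
  by rewrite !inE fadj (inj_eq finj).
have [g gP] : exists g : nat -> nat, forall i, i < n ->
    g i < n /\ labH (g i) = f (labG i).
  exists (fun i => index (f (labG i)) [seq labH j | j <- iota 0 n]) => i ilt.
  have yl : f (labG i) \in [seq labH j | j <- iota 0 n].
    by have [j jlt <-] := labH_surj (f (labG i)); rewrite map_f // mem_iota.
  have jlt := yl; rewrite -index_mem size_map size_iota in jlt; split=> //.
  rewrite -[RHS](nth_index (f (labG i)) yl) (nth_map 0) ?size_iota //.
  by rewrite nth_iota.
have cardrow (K : sgraph) (lab : nat -> K) c i :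
    {in gtn n &, injective lab} -> (forall x, exists2 i, i < n & lab i = x) ->
    bit c =2 cadj n lab -> i < n ->
    count id (nth [::] c i) = #|closed_nbh (lab i)|.
  move=> li ls cE ilt; apply/eqP; rewrite eqn_leq; apply/andP; split.
    by apply: (within_card li) => j; rewrite -/(bit c i j) cE => /and3P[].
  by apply: (covers_card ls) => j jlt; rewrite -/(bit c i j) cE /cadj ilt jlt.
apply: (embeds_complete (f := g)) sa sb _ _ srow _ _ =>
  [i /gP[]//|i j ilt jlt gij|i ilt|i j ilt jlt].
- apply: labG_inj => //; apply: finj.
  by rewrite -(gP i ilt).2 -(gP j jlt).2 gij.
- rewrite (cardrow G labG) // (cardrow H labH) ?(gP i ilt).1 // (gP i ilt).2.
  rewrite -(card_imset _ finj); apply: eq_card => y; apply/imsetP/idP.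
    by case=> x xN ->; rewrite fN.
  have [f' _ f'K] := fbij; move=> yN; exists (f' y); rewrite ?f'K //.
  by rewrite -fN f'K.
- by rewrite aE bE /cadj ilt jlt !(gP _ _).1 // !(gP _ _).2 // fN.
Qed.

End LabelledPair.

(** * Breaking the symmetry *)

(** The exchange of k and k + 1, on indices and on edges. *)
Definition swap (k i : nat) : nat :=
  if i == k then k.+1 else if i == k.+1 then k else i.

Definition swap_edge k (v : nat * nat) :=
  let i := swap k v.1 in let j := swap k v.2 in
  if i < j then (i, j) else (j, i).

(** The edges of vs paired with their images under the exchange, without the
    pairs that carry no information: those of a fixed edge, and those of an edge
    whose image comes earlier. *)
Fixpoint swap_pairs k (seen vs : seq (nat * nat)) :=
  if vs is v :: vs' then
    let w := swap_edge k v in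
    if (v == w) || (w \in seen) then swap_pairs k seen vs'
    else (v, w) :: swap_pairs k (v :: seen) vs'
  else [::].

(** Binary value of a bit vector, so that on vectors of the same size the order
    is lexicographic. *)
Fixpoint code (s : bitseq) : nat :=
  if s is b :: s' then b * 2 ^ size s' + code s' else 0.

Lemma code_lt s : code s < 2 ^ size s.
Proof.
elim: s => //= b s IH; rewrite expnS mul2n -addnn -addnS leq_add //.
by case: b; rewrite ?mul1n ?mul0n.
Qed.

Lemma swapK k : involutive (swap k).
Proof.
move=> i; rewrite /swap; have [->|ik] := eqVneq i k.
  by rewrite eqxx gtn_eqF.
have [->|ik1] := eqVneq i k.+1; first by rewrite eqxx.
by rewrite (negPf ik) (negPf ik1).
Qed.

Lemma swap_lt n k i : k.+1 < n -> i < n -> swap k i < n.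
Proof.
move=> kn ilt; rewrite /swap; case: eqP => // _; case: eqP => // _.
exact: ltnW.
Qed.

Lemma swap_leq k i m : k != m -> (swap k i <= m) = (i <= m).
Proof.
move=> km; rewrite /swap; have [->|_] := eqVneq i k.
  by rewrite [RHS]leq_eqVlt (negPf km).
by have [->|//] := eqVneq i k.+1; rewrite [LHS]leq_eqVlt (negPf km).
Qed.

Lemma swap_fix (k i : nat) : i != k -> i != k.+1 -> swap k i = i.
Proof. by rewrite /swap => /negPf -> /negPf ->. Qed.

Section Symmetry.
Variables (G : sgraph) (n : nat) (lab : nat -> G) (k : nat).

Notation M v := (cadj n lab v.1 v.2).

Lemma cadj_swap_edge v : M (swap_edge k v) = cadj n lab (swap k v.1) (swap k v.2).
Proof. by rewrite /swap_edge; case: ifP => //= _; rewrite cadjC. Qed.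

Lemma cadj_swap2 v :
  cadj n lab (swap k (swap_edge k v).1) (swap k (swap_edge k v).2) = M v.
Proof.
rewrite /swap_edge; case: ifP => _ /=; rewrite !swapK //.
exact: cadjC.
Qed.

Lemma swap_pairs_lex seen vs :
  (forall v, v \in seen -> M v = M (swap_edge k v)) ->
  lex_ge n lab [seq (v, swap_edge k v) | v <- vs] ->
  lex_ge n lab (swap_pairs k seen vs).
Proof.
elim: vs seen => //= v vs IH seen Hs.
have [red|_ /=] := boolP ((v == swap_edge k v) || (swap_edge k v \in seen)).
  suff -> : M v = M (swap_edge k v) by rewrite eqxx; apply: IH.
  case/orP: red => [/eqP <- //|/Hs ->].
  by rewrite [RHS]cadj_swap_edge cadj_swap2.
case: eqP => // e; apply: IH => u; rewrite inE => /predU1P[->|/Hs] //.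
Qed.

Lemma lex_code (vs : seq (nat * nat)) :
  code [seq M (swap_edge k v) | v <- vs] <= code [seq M v | v <- vs] ->
  lex_ge n lab [seq (v, swap_edge k v) | v <- vs].
Proof.
elim: vs => //= v vs IH; rewrite !size_map.
case: (M v) (M (swap_edge k v)) => [] [] //=.
- by rewrite leq_add2l.
- rewrite mul1n mul0n add0n leqNgt; case/negP.
  apply: leq_trans (code_lt _) _; rewrite size_map; exact: leq_addr.
Qed.

End Symmetry.

(** * The six searches *)

(** What is known of the pair ij at the start, when 0 has the neighbours
    1, ..., D and s dominates exactly D + 1, ..., D + c among the other
    vertices. *)
Definition forced D c s i j : option bool :=
  if i == j then Some true else if i == 0 then Some (j <= D) else
  if (i == s) && (D < j) then Some (j <= D + c) else None.

Definition forced_edge D c s i j : option bool :=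
  if forced D c s i j is Some b then Some b else forced D c s j i.

Definition tabulate T (f : nat -> nat -> T) : seq (seq T) :=
  [seq [seq f i j | j <- iota 0 11] | i <- iota 0 11].

Definition lower0 D c s : mat :=
  tabulate (fun i j => forced_edge D c s i j == Some true).
Definition upper0 D c s : mat :=
  tabulate (fun i j => forced_edge D c s i j != Some false).

(** The order of branching. Let V be the set of vertices left undominated by 0
    and s, and W the set of the others except 0: first the edges inside V, then
    those between W and V, then those inside W. For (D, c) = (4, 1) the set V is
    larger, and the reverse order of blocks makes the search smaller. *)
Definition branch_order D c : seq (nat * nat) :=
  let W := iota 1 (D + c) in let V := iota (D + c).+1 (10 - (D + c)) in
  let edges (A B : seq nat) :=
    [seq v <- [seq (i, j) | i <- A, j <- B] | v.1 < v.2] in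
  if D + c == 5 then edges W W ++ edges W V ++ edges V V
  else edges V V ++ edges W V ++ edges W W.

(** Exchanging the labels k and k + 1 keeps the shape of the labelling. *)
Definition swappable D c s k :=
  [&& 0 < k, k < 10, k != s, k.+1 != s, k != D & k != D + c].

(** No exchange of consecutive labels that keeps the shape of the labelling gives
    a lexicographically larger graph. *)
Definition lex0 D c s :=
  [seq swap_pairs k [::] (branch_order D c) | k <- iota 0 11 & swappable D c s k].

(** The vertices left undominated by 0 and s. *)
Definition leftover D c : bitseq := [seq D + c < i | i <- iota 0 11].

(** The search for maximum degree D, with c vertices newly dominated by s. *)
Definition run_search targets D c s : bool :=
  search 11 D (leftover D c) targets (branch_order D c) (lex0 D c s)
    (lower0 D c s) (upper0 D c s).

Lemma bit_tabulate (f : nat -> nat -> bool) i j :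
  bit (tabulate f) i j = [&& i < 11, j < 11 & f i j].
Proof.
rewrite /bit /tabulate; have [ilt|ige] := ltnP i 11; last first.
  by rewrite (nth_default [::]) ?size_map ?size_iota // nth_nil.
rewrite (nth_map 0) ?size_iota // nth_iota // add0n.
have [jlt|jge] := ltnP j 11; last by rewrite nth_default ?size_map ?size_iota.
by rewrite (nth_map 0) ?size_iota // nth_iota.
Qed.

Section Labelling.
Variables (G : sgraph) (v s : G) (D c s0 : nat).
Hypothesis card_G : #|G| = 11.
Hypothesis s0_gt0 : 0 < s0 < 11.
Implicit Types (h : {ffun 'I_11 -> G}) (i j k : nat).

(** Labellings are functions on the finite type of indices, so that one of them
    maximises a given code. *)
Definition labels (h : {ffun 'I_11 -> G}) i : G := h (inord i).

(** The labellings of the shape described by [forced], with v labelled 0 and s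
    labelled s0. *)
Definition valid (h : {ffun 'I_11 -> G}) : bool :=
  [&& injectiveb h, h (inord 0) == v, h (inord s0) == s,
      [forall i : 'I_11, (h i \in closed_nbh v) == (i <= D)]
    & [forall i : 'I_11, (D < i) ==> ((h i \in closed_nbh s) == (i <= D + c))]].

Lemma validP (h : {ffun 'I_11 -> G}) :
  reflect [/\ injective h, labels h 0 = v, labels h s0 = s,
    forall i, i < 11 -> (labels h i \in closed_nbh v) = (i <= D)
    & forall i, i < 11 -> D < i -> (labels h i \in closed_nbh s) = (i <= D + c)]
    (valid h).
Proof.
apply: (iffP and5P) => [[/injectiveP hi /eqP h0 /eqP hs /forallP hD /forallP hc]|].
  split=> // i ilt; first by rewrite (eqP (hD _)) inordK.
  by move=> Di; have := implyP (hc (inord i)); rewrite inordK // => /(_ Di)/eqP.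
case=> hi h0 hs hD hc; split; try exact/eqP; first exact/injectiveP.
  by apply/forallP=> i; rewrite -(hD i) // /labels inord_val.
apply/forallP=> i; apply/implyP=> Di.
by rewrite -(hc i) // /labels inord_val.
Qed.

Lemma labels_inj (h : {ffun 'I_11 -> G}) :
  injective h -> {in gtn 11 &, injective (labels h)}.
Proof.
move=> hi i j ilt jlt /hi e.
by rewrite -(inordK ilt) e inordK.
Qed.

Lemma labels_surj (h : {ffun 'I_11 -> G}) :
  injective h -> forall x, exists2 i, i < 11 & labels h i = x.
Proof.
move=> hi x; have [|h' _ h'K] := inj_card_bij hi; first by rewrite card_G card_ord.
by exists (h' x) => //; rewrite /labels inord_val h'K.
Qed.

Definition swap_labels k (h : {ffun 'I_11 -> G}) : {ffun 'I_11 -> G} :=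
  [ffun i : 'I_11 => h (inord (swap k i))].

Lemma labels_swap k h i : k < 10 -> i < 11 ->
  labels (swap_labels k h) i = labels h (swap k i).
Proof. by move=> klt ilt; rewrite /labels ffunE inordK. Qed.

Lemma valid_swap k h : swappable D c s0 k -> valid h -> valid (swap_labels k h).
Proof.
case/and5P=> k0 klt ks0 k1s0 /andP[kD kc] /validP[hi h0 hs hD hc].
have /andP[s00 s0lt] := s0_gt0.
apply/validP; split.
- move=> i j; rewrite !ffunE => /hi /(congr1 (@nat_of_ord 11)).
  rewrite !inordK ?swap_lt // => /(can_inj (swapK k)); exact: val_inj.
- by rewrite labels_swap // swap_fix // eq_sym // -lt0n.
- by rewrite labels_swap // swap_fix // eq_sym.
- by move=> i ilt; rewrite labels_swap // hD ?swap_lt // swap_leq.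
- move=> i ilt Di; rewrite labels_swap // hc ?swap_lt // ?swap_leq //.
  by rewrite ltnNge swap_leq // -ltnNge.
Qed.

(** The integer whose binary digits are the adjacencies, in the order of
    branching. *)
Definition edge_code (h : {ffun 'I_11 -> G}) : nat :=
  code [seq cadj 11 (labels h) e.1 e.2 | e <- branch_order D c].

Lemma cadj_swap_labels k h i j : k < 10 ->  i < 11 -> j < 11 ->
  cadj 11 (labels (swap_labels k h)) i j = cadj 11 (labels h) (swap k i) (swap k j).
Proof.
by move=> klt ilt jlt; rewrite /cadj ilt jlt !swap_lt // !labels_swap.
Qed.

Lemma branch_order_lt : D + c <= 10 ->
  all (fun e => (e.1 < 11) && (e.2 < 11)) (branch_order D c).
Proof.
move=> Dc; have edges_lt (A B : seq nat) : all (gtn 11) A -> all (gtn 11) B ->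
    all (fun e => (e.1 < 11) && (e.2 < 11))
      [seq e <- [seq (i, j) | i <- A, j <- B] | e.1 < e.2].
  move=> /allP lA /allP lB; apply/allP => e; rewrite mem_filter => /andP[_].
  by case/allpairsP => -[i j] /= [/lA iA /lB jB ->]; apply/andP.
have lW : all (gtn 11) (iota 1 (D + c)).
  apply/allP=> i; rewrite mem_iota => /andP[_ ilt] /=.
  by apply: leq_trans ilt _; rewrite add1n ltnS.
have lV : all (gtn 11) (iota (D + c).+1 (10 - (D + c))).
  by apply/allP=> i; rewrite mem_iota addSn subnKC // => /andP[_ ilt].
by rewrite /branch_order; case: ifP => _; rewrite !all_cat !edges_lt.
Qed.

Lemma lex0P h : D + c <= 10 -> valid h ->
  (forall h', valid h' -> edge_code h' <= edge_code h) ->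
  all (lex_ge 11 (labels h)) (lex0 D c s0).
Proof.
move=> Dc hv hmax; apply/allP => l /mapP[k]; rewrite mem_filter => /andP[kok _] ->.
have klt : k < 10 by case/and5P: kok.
apply: swap_pairs_lex => //; apply: lex_code.
apply: leq_trans (hmax _ (valid_swap kok hv)).
rewrite /edge_code leq_eqVlt; apply/orP; left; apply/eqP; congr code.
apply/eq_in_map => e /(allP (branch_order_lt Dc))/andP[e1 e2].
by rewrite cadj_swap_edge cadj_swap_labels.
Qed.

Lemma fits0 h : valid h -> fits 11 (labels h) (lower0 D c s0) (upper0 D c s0).
Proof.
case/validP=> hi h0 hs hD hc.
have fE i j b : i < 11 -> j < 11 -> forced D c s0 i j = Some b ->
    cadj 11 (labels h) i j = b.
  move=> ilt jlt; rewrite /cadj ilt jlt /= /forced.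
  case: eqP => [-> [<-]|_]; first by rewrite closed_nbh_refl.
  case: eqP => [-> [<-]|_]; first by rewrite h0 hD.
  by case: andP => // -[/eqP -> Dj] [<-]; rewrite hs hc.
have feE i j b : i < 11 -> j < 11 -> forced_edge D c s0 i j = Some b ->
    cadj 11 (labels h) i j = b.
  move=> ilt jlt; rewrite /forced_edge.
  case fij: (forced D c s0 i j) => [b'|]; first by case=> <-; apply: fE.
  by rewrite cadjC; apply: fE.
split; try by rewrite size_map size_iota.
  by move=> i j; rewrite bit_tabulate => /and3P[ilt jlt /eqP]; apply: feE.
move=> i j ij; have /and3P[ilt jlt _] := ij.
rewrite bit_tabulate ilt jlt; apply/eqP => /(feE _ _ _ ilt jlt).
by rewrite ij.
Qed.

Lemma run_search_sound targets : within2 G -> ~~ finish 4 true [set: G] ->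
  (forall x : G, #|closed_nbh x| <= D.+1) ->
  (forall x : G, 1 < #|~: closed_nbh v :\: closed_nbh s :\: closed_nbh x|) ->
  D + c <= 10 -> (exists h, valid h) -> run_search targets D c s0 ->
  exists (h : {ffun 'I_11 -> G}) Z, [/\ injective h, size Z = 11,
    bit Z =2 cadj 11 (labels h) & has (fun b => embeds Z b [::]) targets].
Proof.
move=> cl nofin deg cap Dc [h1 h1v] runt.
(* Among the valid labellings, take one whose edge code is maximal. *)
case: (@arg_maxnP _ h1 valid edge_code h1v) => h hv hmax.
have [hi h0 hs hD hc] := validP _ hv.
have TU : covers 11 (labels h) (~: closed_nbh v :\: closed_nbh s) (leftover D c).
  move=> i ilt; rewrite in_setD in_setC => /andP[nis niv].
  rewrite (nth_map 0) ?size_iota // nth_iota // add0n.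
  have Di : D < i by rewrite ltnNge -hD.
  by rewrite ltnNge -hc.
have [Z [sZ ZE ZT]] := search_sound (labels_inj hi) (labels_surj hi)
  cl deg TU cap nofin
  (branch_order_lt Dc) (lex0P Dc hv hmax) (fits0 hv) runt.
by exists h, Z.
Qed.

End Labelling.

(** * Existence of a labelling *)

Section FirstLabelling.
Variables (G : sgraph) (v s : G).
Hypothesis card_G : #|G| = 11.
Let D := #|nbh v|.
Let C := closed_nbh s :\: closed_nbh v.
Let T := ~: closed_nbh v :\: closed_nbh s.
Hypothesis sC : C != set0.

Lemma enum_head (A : {set G}) x : x \in A ->
  exists2 l, uniq (x :: l) & x :: l =i A.
Proof.
move=> xA; exists (enum (A :\ x)).
  by rewrite /= enum_uniq mem_enum in_setD1 eqxx.
by move=> y; rewrite in_cons mem_enum in_setD1; have [->|] := eqVneq y x.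
Qed.

(** The label of s is 1 if s is a neighbour of v, and else the first one after
    the neighbours of v. *)
Lemma exists_valid :
  exists h, valid v s D #|C| (if s \in closed_nbh v then 1 else D.+1) h.
Proof.
have sv : s != v.
  by apply: contra_neq sC; rewrite /C => ->; exact: setDv.
have [l1 [u1 e1 v1 s1]] : exists l, [/\ uniq l, l =i closed_nbh v, nth v l 0 = v &
    s \in closed_nbh v -> nth v l 1 = s].
  have [sN|sN] := boolP (s \in closed_nbh v); last first.
    by have [l ul el] := enum_head (closed_nbh_refl v); exists (v :: l).
  have [|l ul el] := @enum_head (closed_nbh v :\ v) s; first by rewrite in_setD1 sv.
  exists [:: v, s & l]; split=> //.
    by rewrite cons_uniq ul el in_setD1 eqxx.
  move=> y; rewrite in_cons el in_setD1.
  by have [->|] := eqVneq y v; rewrite ?closed_nbh_refl.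
have [l2 [u2 e2 s2]] : exists l, [/\ uniq l, l =i C &
    s \notin closed_nbh v -> nth v l 0 = s].
  have [sN|sN] := boolP (s \in closed_nbh v).
    by exists (enum C); split=> // [|y]; rewrite ?enum_uniq ?mem_enum.
  have [|l ul el] := @enum_head C s; first by rewrite in_setD sN closed_nbh_refl.
  by exists (s :: l).
(* The labelling lists the neighbourhood of v, then C, then T. *)
pose l3 := enum T; pose l := l1 ++ l2 ++ l3.
have z1 : size l1 = D.+1 by rewrite -(card_uniqP u1) (eq_card e1) card_closed_nbh.
have z2 : size l2 = #|C| by rewrite -(card_uniqP u2) (eq_card e2).
have ul : uniq l.
  rewrite !cat_uniq u1 u2 enum_uniq /= andbT; apply/andP; split.
    apply/hasPn => y; rewrite mem_cat mem_enum /= e1 e2 !inE.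
    by case/orP => [/andP[]|/andP[_]].
  apply/hasPn => y; rewrite mem_enum /= e2 !inE.
  by case/andP => /negPf ->; rewrite andbF.
have zl : size l = 11.
  rewrite -card_G -(card_uniqP ul); apply: eq_card => y.
  rewrite !mem_cat mem_enum e1 e2 !in_setD !in_setC [RHS]inE.
  by case: (y \in _); case: (y \in _).
have nth1 i : i < 11 -> (nth v l i \in closed_nbh v) = (i <= D).
  move=> ilt; rewrite nth_cat z1 ltnS; case: leqP => iD.
    by rewrite -e1 mem_nth // z1.
  apply/negbTE; have : nth v (l2 ++ l3) (i - D.+1) \in l2 ++ l3.
    by rewrite mem_nth // -(ltn_add2l D.+1) subnKC // -z1 -size_cat zl.
  rewrite mem_cat e2 mem_enum !in_setD in_setC.
  by case/orP => /andP[].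
have nth2 i : i < 11 -> D < i -> (nth v l i \in closed_nbh s) = (i <= D + #|C|).
  move=> ilt Di; rewrite nth_cat z1 ltnNge Di /= nth_cat z2 -(ltn_add2l D.+1) subnKC //.
  rewrite addSn ltnS; case: leqP => iC.
    have : nth v l2 (i - D.+1) \in l2.
      by rewrite mem_nth // z2 -(ltn_add2l D.+1) subnKC.
    by rewrite e2 in_setD => /andP[].
  apply/negbTE; have : nth v l3 (i - D.+1 - #|C|) \in l3.
    rewrite mem_nth // -(ltn_add2l (D.+1 + #|C|)) -subnDA subnKC //.
    by rewrite -z1 -z2 -addnA -!size_cat zl.
  by rewrite mem_enum !in_setD => /andP[].
exists [ffun i : 'I_11 => nth v l i]; apply/validP; rewrite /labels; split.
- move=> i j; rewrite !ffunE => /eqP; rewrite nth_uniq ?zl // => /eqP; exact: val_inj.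
- by rewrite ffunE inordK // nth_cat z1.
- have [sN|sN] := boolP (s \in closed_nbh v).
    rewrite ffunE inordK // nth_cat z1 s1 // ltnS.
    rewrite /D (cardD1 s) in_setD1 sv sN //.
  have C0 : 0 < #|C| by rewrite card_gt0.
  have lt : D.+1 < 11.
    rewrite -zl !size_cat z1 z2 -addn1 leq_add2l.
    by rewrite (leq_trans C0) // leq_addr.
  by rewrite ffunE inordK // !nth_cat z1 z2 ltnn subnn C0 s2.
- by move=> i ilt; rewrite ffunE inordK // nth1.
- by move=> i ilt Di; rewrite ffunE inordK // nth2.
Qed.

End FirstLabelling.

(** * The ten graphs *)

(** The graph on 0, ..., 10 with an edge xy whenever y is in the list of x, or
    conversely. *)
Definition listed_adj (t : seq (seq nat)) : rel 'I_11 :=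
  fun x y => (x != y) && ((val y \in nth [::] t x) || (val x \in nth [::] t y)).

Lemma listed_sym t : symmetric (listed_adj t).
Proof. by move=> x y; rewrite /listed_adj eq_sym orbC. Qed.

Lemma listed_irr t : irreflexive (listed_adj t).
Proof. by move=> x; rewrite /listed_adj eqxx. Qed.

Definition listed_graph t : sgraph := SGraph (listed_sym t) (@listed_irr t).

(** The closed adjacency matrix of [listed_graph]. *)
Definition listed_mat t : mat :=
  tabulate (fun i j => [|| i == j, j \in nth [::] t i | i \in nth [::] t j]).

Lemma listed_matE t :
  bit (listed_mat t) =2 @cadj (listed_graph t) 11 (@inord 10).
Proof.
move=> i j; rewrite bit_tabulate /cadj.
case ilt: (i < 11) => //=; case jlt: (j < 11) => //=.
rewrite inE /= /listed_adj !inordK // eq_sym -(inj_eq val_inj) /= !inordK //.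
by rewrite -(inj_eq val_inj) /= !inordK // eq_sym; case: eqP.
Qed.

Lemma inord11_inj : {in gtn 11 &, injective (@inord 10)}.
Proof. by move=> i j ilt jlt e; rewrite -(inordK ilt) e inordK. Qed.

Lemma inord11_surj (x : 'I_11) : exists2 i, i < 11 & inord i = x.
Proof. by exists x => //; rewrite inord_val. Qed.

(** The ten graphs; the list of a vertex holds its neighbours with larger
    label. Vertex 0 has maximum degree, and is never adjacent to 10. *)
Definition extremal : seq (seq (seq nat)) := [::
[:: [:: 1; 2; 3; 4; 5]; [:: 2; 6]; [:: 7; 9]; [:: 7; 10]; [:: 5; 6; 7]; [:: 8; 9]; [:: 8; 10]; [:: 8]; [::]; [:: 10]];
[:: [:: 1; 2; 3; 4; 5]; [:: 3; 4; 6]; [:: 6; 7; 9]; [:: 7; 10]; [:: 8; 9]; [:: 6; 8; 10]; [::]; [:: 8]; [::]; [:: 10]];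
[:: [:: 1; 2; 3; 4; 5]; [:: 2; 6]; [:: 7; 9]; [:: 7; 10]; [:: 5; 8; 9]; [:: 6; 8]; [:: 8; 10]; [:: 8]; [::]; [:: 10]];
[:: [:: 1; 2; 3; 4; 5]; [:: 2; 6]; [:: 7; 9]; [:: 5; 7; 10]; [:: 5; 8; 9]; [:: 6]; [:: 8; 10]; [:: 8]; [::]; [:: 10]];
[:: [:: 1; 2; 3; 4; 5]; [:: 2; 5; 6]; [:: 7; 9]; [:: 5; 7; 10]; [:: 5; 8; 9]; [::]; [:: 8; 10]; [:: 8]; [::]; [:: 10]];
[:: [:: 1; 2; 3; 4]; [:: 5; 6]; [:: 5; 7; 9]; [:: 7; 9]; [:: 8; 10]; [:: 7; 10]; [:: 8; 9]; [:: 8]; [::]; [:: 10]];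
[:: [:: 1; 2; 3; 4]; [:: 5; 6]; [:: 7; 9]; [:: 7; 9]; [:: 5; 8; 10]; [:: 7; 10]; [:: 8; 9]; [:: 8]; [::]; [:: 10]];
[:: [:: 1; 2; 3; 4]; [:: 5; 6]; [:: 3; 7; 9]; [:: 7; 9]; [:: 8; 10]; [:: 7; 10]; [:: 8; 9]; [:: 8]; [::]; [:: 10]];
[:: [:: 1; 2; 3; 4]; [:: 5; 6]; [:: 7; 9]; [:: 7; 9]; [:: 8; 10]; [:: 7; 10]; [:: 8; 9]; [:: 8]; [::]; [:: 10]];
[:: [:: 1; 2; 3; 4]; [:: 5; 6]; [:: 6; 7; 9]; [:: 7; 10]; [:: 8; 9]; [:: 7; 9]; [:: 8; 10]; [:: 8]; [::]; [:: 10]]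
].

Definition extremal_mats : seq mat := map listed_mat extremal.

(** Diameter 2, and Dominator finishes within five moves but not within four. *)
Definition mat_ok (b : mat) : bool :=
  [&& all (fun r => all (meets r) b) b, ~~ bit b 0 10,
      ~~ bfinish b b 4 true (nseq 11 true) & bfinish b b 5 true (nseq 11 true)].

Lemma extremal_ok : all mat_ok extremal_mats.
Proof. by vm_compute. Qed.

Lemma extremal_distinct :
  all (fun i => all (fun j =>
    embeds (nth [::] extremal_mats i) (nth [::] extremal_mats j) [::] ==> (i == j))
    (iota 0 10)) (iota 0 10).
Proof. by vm_compute. Qed.

Lemma six_searches : all (fun p => run_search extremal_mats p.1.1 p.1.2 p.2)
  [:: (5, 1, 1); (5, 1, 6); (4, 1, 1); (4, 1, 5); (4, 2, 1); (4, 2, 5)].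
Proof. by vm_compute. Qed.

Lemma listed_spec t : t \in extremal ->
  diam (listed_graph t) = Some 2 /\ game_domination_number (listed_graph t) = 5.
Proof.
move=> tE; have := allP extremal_ok _ (map_f listed_mat tE).
set b := listed_mat t => /and4P[bcl b0 b4 b5].
pose K := listed_graph t; have bE : bit b =2 @cadj K 11 (@inord 10) := listed_matE t.
have sb : size b = 11 by rewrite size_map size_iota.
have fit : @fits K 11 (@inord 10) b b by split=> // i j; rewrite bE.
have cl : within2 K.
  move=> x y; have [i ilt <-] := inord11_surj x; have [j jlt <-] := inord11_surj y.
  have /(all_nthP [::])/(_ i) := bcl; rewrite sb => /(_ ilt)/(all_nthP [::])/(_ j).
  rewrite sb => /(_ jlt)/meetsP[k].
  rewrite -/(bit b i k) -/(bit b j k) !bE => /andP[/and3P[_ klt ik] /and3P[_ _ jk]].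
  by exists (inord k : K); rewrite closed_nbhC.
split.
  apply/diam2P; split=> //; exists (inord 0 : K), (inord 10 : K).
  by move: b0; rewrite bE.
apply/eqP; rewrite eqn_leq !gamma_finish.
have -> : finish 5 true [set: K].
  exact: (@bfinish_sound K 11 (@inord 10) inord11_surj b b 5 true setT _ cl fit
    (@covers_full K 11 _) b5).
rewrite ltnNge gamma_finish; apply: contra b4.
exact: (@bfinish_complete K 11 (@inord 10) inord11_inj inord11_surj b 4 true
  setT _ fit (@within_full K 11 _)).
Qed.

(** * The classification *)

(** If Dominator cannot finish within four moves, then Staller has a reply to
    the opening v after which Dominator cannot finish within two. *)
Lemma nofin_reply (G : sgraph) (v : G) : ~~ finish 4 true [set: G] ->
  exists2 s, closed_nbh s :\: closed_nbh v != set0 &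
    ~~ finish 2 true (~: closed_nbh v :\: closed_nbh s).
Proof.
rewrite [finish _ _ _]/= negb_or => /andP[_ /existsPn/(_ v)].
rewrite negb_or => /andP[_ /forallPn[s]]; rewrite negb_imply => /andP[sC nf].
rewrite setTD in sC nf; exists s; first by rewrite setDE.
exact: nf.
Qed.

Lemma extremal_complete (G : sgraph) : #|G| = 11 -> diam G = Some 2 ->
  4 < game_domination_number G ->
  exists2 t, t \in extremal & isomorphic G (listed_graph t).
Proof.
move=> cG /diam2P[cl _]; rewrite ltnNge gamma_finish => nofin.
have x0 : G by apply: (enum_val (A := G)); rewrite cG; exact: ord0.
(* v is a vertex of maximum degree. *)
have [v _ vmax] := arg_maxnP (fun x => #|nbh x|) (erefl (xpredT x0)).
have deg (x : G) : #|closed_nbh x| <= #|nbh v|.+1.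
  by rewrite card_closed_nbh ltnS; apply: vmax.
have [s sC nf] := nofin_reply v nofin.
have cap x : 1 < #|~: closed_nbh v :\: closed_nbh s :\: closed_nbh x|.
  rewrite ltnNge; apply: contra nf => le1; apply/orP; right.
  by apply/existsP; exists x; apply: finish1_card.
have T4 : 3 < #|~: closed_nbh v :\: closed_nbh s|.
  by rewrite ltnNge; apply: contra nf => /(finish2_card cl).
have D3 : 3 < #|nbh v|.
  rewrite ltnNge; apply/negP => D3; have := @moore G v 3 cl.
  rewrite cG => H; suff : 10 < 10 by [].
  by apply: H => x; rewrite (leq_trans (deg x)).
have sum11 : #|nbh v| + #|closed_nbh s :\: closed_nbh v| +
    #|~: closed_nbh v :\: closed_nbh s| = 10.
  apply: succn_inj; rewrite -cG -(cardsC (closed_nbh v)) card_closed_nbh.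
  rewrite -(cardsID (closed_nbh s) (~: _)) addnA !addSn; congr (_ + _ + _).+1.
  by rewrite setIC -setDE.
have c0 : 0 < #|closed_nbh s :\: closed_nbh v| by rewrite card_gt0.
have ex := exists_valid cG sC.
set D := #|nbh v| in deg D3 sum11 ex.
set c := #|closed_nbh s :\: closed_nbh v| in sum11 c0 ex.
have Dc : D + c <= 6.
  by rewrite -(leq_add2r 4) -[X in _ <= X]sum11 leq_add2l.
set s0 := if _ then _ else _ in ex.
have rn : run_search extremal_mats D c s0.
  have small a b : 3 < a -> 0 < b -> a + b <= 6 ->
      (a, b) \in [:: (5, 1); (4, 1); (4, 2)].
    by case: a => [|[|[|[|[|[|a]]]]]]; case: b => [|[|[|b]]]; rewrite ?addnS.
  have := small D c D3 c0 Dc.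
  rewrite !inE /s0; have /and5P[r1 r2 r3 r4 /and3P[r5 r6 _]] := six_searches.
  by case/or3P => /eqP[-> ->]; case: ifP.
have s0lt : 0 < s0 < 11.
  rewrite /s0; case: ifP => //= _; rewrite !ltnS.
  by rewrite (leq_trans (leq_addr c D)) // (leq_trans Dc).
have [h [Z [hi sZ ZE]]] := run_search_sound cG s0lt cl nofin deg cap
  (leq_trans Dc (isT : 6 <= 10)) ex rn.
case/hasP=> b /mapP[t tE ->] emb; exists t => //.
have st : size (listed_mat t) = 11 by rewrite size_map size_iota.
exact: (@isomorphic_embeds G (listed_graph t) 11 (labels h) (@inord 10)
  (labels_inj hi) (labels_surj cG hi) inord11_inj inord11_surj Z _ sZ st ZE
  (listed_matE t) emb).
Qed.

Theorem mainTheorem3 :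
  (exists L : 'I_10 -> sgraph,
    [/\ forall i, [/\ #|L i| = 11, diam (L i) = Some 2
                    & game_domination_number (L i) = 5],
        forall i j, isomorphic (L i) (L j) -> i = j
      & forall G : sgraph, #|G| = 11 -> diam G = Some 2 ->
          game_domination_number G = 5 -> exists i, isomorphic G (L i)])
  /\
  (forall G : sgraph, #|G| = 11 -> diam G = Some 2 ->
     (game_domination_number G = 5 <->
      game_domination_number G = uphalf #|G| - #|G| %/ 11)).
Proof.
(* The upper half of 11 is 6, and 6 - 11 %/ 11 = 5. *)
split; last by move=> G -> _.
exists (fun i => listed_graph (nth [::] extremal i)); split.
- move=> i; have tE : nth [::] extremal i \in extremal.
    by apply: mem_nth; apply: ltn_ord.
  by have [] := listed_spec tE; rewrite card_ord.
- move=> i j iso; apply/val_inj/eqP => /=.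
  have /allP/(_ (val i)) := extremal_distinct; rewrite mem_iota ltn_ord => /(_ isT).
  move=> /allP/(_ (val j)); rewrite mem_iota ltn_ord => /(_ isT)/implyP; apply.
  rewrite !(nth_map [::]) ?ltn_ord //.
  have sm t : size (listed_mat t) = 11 by rewrite size_map size_iota.
  apply: (@embeds_isomorphic (listed_graph _) (listed_graph _) 11 (@inord 10)
    (@inord 10) inord11_inj inord11_surj inord11_inj inord11_surj _ _ (sm _) (sm _)
    (listed_matE _) (listed_matE _) _ iso) => k klt.
  by rewrite (nth_map 0) ?size_iota // size_map size_iota.
- move=> G cG dG gG; have [|t /(nthP [::])[i ilt <-] iso] := extremal_complete cG dG.
    by rewrite gG.
  by exists (Ordinal ilt).
Qed.
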